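(* There exist universal constants $0<c\le C<\infty$ such that for every $1<r\le\infty$ and $n\in\mathbb{N}$, every $f:\{-1,1\}^n\to\mathbb{R}$ satisfies $$c\,Q(f)\le \inf_{g\in \mathscr{P}^n_{>1}} \|f-g\|_{r}\le C\,Q(f),\qquad Q(f)= |\mathbb{E}f|+ \max_{i\in\{1,\ldots,n\}} \big| \widehat{f}(\{i\})\big| + \sqrt{\frac{r-1}{r}} \Big(\sum_{i=1}^n \widehat{f}(\{i\})^2\Big)^{1/2}$$ (with $\frac{r-1}{r}=1$ when $r=\infty$).
   Context: Every $f:\{-1,1\}^n\to\mathbb{R}$ has a unique Fourier–Walsh expansion $f=\sum_{S\subseteq\{1,\dots,n\}}\widehat f(S)w_S$, where $w_S(x)=\prod_{i\in S}x_i$. $\mathscr{P}^n_{>1}=\{f:\{-1,1\}^n\to\mathbb{R}:\ \widehat f(S)=0 \text{ whenever } |S|\le 1\}$. $\|\cdot\|_r$ is the $L_r$ norm and $\mathbb{E}$ the expectation with respect to the uniform probability measure on $\{-1,1\}^n$. *)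

(* Defs.v *)
From HB Require Import structures.
From mathcomp Require Import all_boot all_order all_algebra.
From mathcomp Require Import all_classical all_reals all_analysis.
From mathcomp Require Import Rstruct Rstruct_topology.
From Stdlib Require Import Rdefinitions.
Set Implicit Arguments. Unset Strict Implicit. Unset Printing Implicit Defensive.
Import Order.TTheory GRing.Theory Num.Theory.
Local Open Scope ring_scope.
Local Open Scope classical_set_scope.

Definition cube (n : nat) := {ffun 'I_n -> bool}.
Definition spin n (x : cube n) (i : 'I_n) : R := if x i then -1 else 1.

Definition walsh n (S : {set 'I_n}) (x : cube n) : R := \prod_(i in S) spin x i.

Definition Ex n (f : cube n -> R) : R := (2 ^+ n)^-1 * \sum_(x : cube n) f x.

Definition fhat n (f : cube n -> R) (S : {set 'I_n}) : R := Ex (fun x => f x * walsh S x).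

Definition Pgt1 n : set (cube n -> R) :=
  [set g | forall S : {set 'I_n}, leq #|S| 1 -> fhat g S = 0].

Definition Lnorm_cube n (r : \bar R) (h : cube n -> R) : R :=
  match r with
  | EFin p => powR (Ex (fun x => powR `|h x| p)) p^-1
  | +oo%E => \big[Num.max/0]_(x : cube n) `|h x|
  | -oo%E => 0
  end.

Definition rfactor (r : \bar R) : R :=
  match r with
  | EFin p => Num.sqrt ((p - 1) / p)
  | _ => 1
  end.

Definition Qf n (r : \bar R) (f : cube n -> R) : R :=
  `|Ex f| + \big[Num.max/0]_(i < n) `|fhat f [set i]|
  + rfactor r * Num.sqrt (\sum_(i < n) fhat f [set i] ^+ 2).

Definition distP n (r : \bar R) (f : cube n -> R) : R :=
  inf [set Lnorm_cube r (fun x => f x - g x) | g in @Pgt1 n].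

(* Main.v *)
(* Only the level-0 and level-1 coefficients a_0, a_1, ..., a_n of f matter.

   Lower bound. For F = f - g, pair F with 1, with x_i and with X = sum_i a_i x_i.
   Young's inequality bounds each pairing by ||F||_r, given a bound on a moment of
   order s = r / (r - 1); for X this is Khinchin's inequality with constant
   O(sqrt s), obtained from the exponential moments of X.

   Upper bound, by an explicit F with the same a_0, ..., a_n. Let Q = Q(f).
   If r <= 2, put b_i = a_i / Q, so that |b_i| <= 1 and sum_i b_i^2 <= s, and take
   F = a_0 + Q (Z - 1) with the Riesz product Z = prod_i (1 + b_i x_i) >= 0. Here
   E Z = 1 and E Z^2 <= exp (sum_i b_i^2), so interpolation between L_1 and L_2 gives
   E Z^r <= exp ((r - 1) sum_i b_i^2) <= e^r.
   If r >= 2, put b_i = a_i / (2 Q), so that sum_i b_i^2 <= 1, and take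
   F = a_0 + 2 Q Im (prod_i (1 + i b_i x_i)), which is bounded by O(Q) because
   |1 + i b_i x_i|^2 = 1 + b_i^2. *)
Require Import Defs.
From mathcomp Require Import all_boot all_order all_algebra.
From mathcomp Require Import complex.
From mathcomp Require Import all_classical all_reals all_analysis.
From mathcomp Require Import Rstruct Rstruct_topology.
From mathcomp Require Import ring lra.
From Stdlib Require Import Rdefinitions.
Import Order.TTheory GRing.Theory Num.Theory.
Local Open Scope ring_scope.

(* The default binding of [R] to Stdlib's [R_scope] would hijack the notations in
   arguments of type [R]. *)
Bind Scope ring_scope with R.

(* [Defs] elaborates [Ex] and [Qf] with the operations of Stdlib's [R_scope]. *)
Lemma ExE n (f : cube n -> R) : Ex f = (2 ^+ n)^-1 * \sum_x f x.
Proof. by []. Qed.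

Lemma QfE n r (f : cube n -> R) : Qf r f =
  `|Ex f| + \big[Num.max/0]_(i < n) `|fhat f [set i]|
  + rfactor r * Num.sqrt (\sum_(i < n) fhat f [set i] ^+ 2).
Proof. by []. Qed.

(** * Expectation and Walsh coefficients on the cube *)

Lemma Ex_ge0 n (f : cube n -> R) : (forall x, 0 <= f x) -> 0 <= Ex f.
Proof. by move=> f0; rewrite ExE mulr_ge0 ?invr_ge0 ?exprn_ge0// sumr_ge0. Qed.

Lemma le_Ex n (f g : cube n -> R) : (forall x, f x <= g x) -> Ex f <= Ex g.
Proof.
by move=> fg; rewrite !ExE ler_wpM2l ?invr_ge0 ?exprn_ge0//; apply: ler_sum => x _.
Qed.

Lemma Ex_cst n (c : R) : Ex (fun _ : cube n => c) = c.
Proof.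
rewrite ExE sumr_const card_ffun card_bool card_ord -[c *+ _]mulr_natl.
rewrite natrX.
by rewrite mulKf// expf_neq0.
Qed.

Lemma ExD n (f g : cube n -> R) : Ex (fun x => f x + g x) = Ex f + Ex g.
Proof. by rewrite !ExE big_split mulrDr. Qed.

Lemma ExZ n (c : R) (f : cube n -> R) : Ex (fun x => c * f x) = c * Ex f.
Proof. by rewrite !ExE -mulr_sumr mulrCA. Qed.

Lemma Ex_sum n (I : finType) (f : I -> cube n -> R) :
  Ex (fun x => \sum_i f i x) = \sum_i Ex (f i).
Proof.
rewrite ExE exchange_big mulr_sumr; apply: eq_bigr => i _; exact/esym/ExE.
 Qed.

Lemma le_norm_Ex n (f : cube n -> R) : `|Ex f| <= Ex (fun x => `|f x|).
Proof.
rewrite !ExE normrM ger0_norm ?invr_ge0 ?exprn_ge0//.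
by rewrite ler_wpM2l ?invr_ge0 ?exprn_ge0// ler_norm_sum.
Qed.

Lemma Ex_eq0 n (f : cube n -> R) :
  (forall x, 0 <= f x) -> Ex f = 0 -> forall x, f x = 0.
Proof.
move=> f0 /eqP; rewrite ExE mulf_eq0 invr_eq0 expf_eq0 pnatr_eq0 andbF/=.
by rewrite psumr_eq0// => /allP h x; apply/eqP/(h x); rewrite mem_index_enum.
Qed.

Lemma sum_cube_prod n (A : comRingType) (phi : 'I_n -> bool -> A) :
  \sum_(x : cube n) \prod_i phi i (x i) = \prod_i (phi i true + phi i false).
Proof.
by rewrite -bigA_distr_bigA; apply: eq_bigr => i _; rewrite big_bool.
Qed.

(** Independence of the coordinates; it reduces the exponential moments of linear forms and the
    second moment of the Riesz product to one coordinate. *)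
Lemma Ex_prod n (phi : 'I_n -> bool -> R) :
  Ex (fun x => \prod_i phi i (x i)) = \prod_i ((phi i true + phi i false) / 2).
Proof.
rewrite ExE sum_cube_prod prodf_div big_const_ord iter_mulr_1.
by rewrite mulrC.
Qed.

Lemma fhatB n (f g : cube n -> R) S :
  fhat (fun x => f x - g x) S = fhat f S - fhat g S.
Proof.
rewrite /fhat -[- Ex _]mulN1r -ExZ -ExD; congr Ex; apply/funext => x; ring.
Qed.

Lemma walsh_set0 n (x : cube n) : walsh finset.set0 x = 1.
Proof. by rewrite /walsh big_set0. Qed.

Lemma walsh_set1 n (x : cube n) i : walsh [set i] x = spin x i.
Proof. by rewrite /walsh big_set1. Qed.

Lemma fhat_set0 n (f : cube n -> R) : fhat f finset.set0 = Ex f.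
Proof. by congr Ex; apply/funext => x; rewrite walsh_set0 mulr1. Qed.

Lemma normr_walsh n S (x : cube n) : `|walsh S x| = 1.
Proof.
rewrite /walsh normr_prod big1// => i _.
by rewrite /spin; case: ifP; rewrite ?normrN normr1.
Qed.

Lemma fhat_linear_form n (F : cube n -> R) (b : 'I_n -> R) :
  Ex (fun x => F x * \sum_i b i * spin x i) = \sum_i b i * fhat F [set i].
Proof.
transitivity (\sum_i Ex (fun x => b i * (F x * walsh [set i] x))).
  rewrite -Ex_sum; congr Ex; apply/funext => x; rewrite mulr_sumr.
  by apply: eq_bigr => i _; rewrite walsh_set1 mulrCA.
by apply: eq_bigr => i _; rewrite ExZ.
Qed.

Lemma fhat_cst n (c : R) k : fhat (fun _ : cube n => c) [set k] = 0.
Proof.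
pose phi (i : 'I_n) (b : bool) : R := if i == k then if b then -1 else 1 else 1.
rewrite /fhat ExZ (_ : walsh [set k] = fun x : cube n => \prod_i phi i (x i)).
  by rewrite Ex_prod (bigD1 k)//= /phi eqxx addNr mul0r mul0r mulr0.
apply/funext => x; rewrite walsh_set1 (bigD1 k)//= /phi eqxx big1 ?mulr1//.
by move=> i /negbTE->.
Qed.

(** * Duality through Young's inequality *)

Lemma young_powR (p s u v : R) : 1 < p -> s = p / (p - 1) -> 0 <= u -> 0 <= v ->
  u * v <= u `^ p + v `^ s.
Proof.
move=> p1 ->u0 v0.
have s1 : 1 <= p / (p - 1) by rewrite ler_pdivlMr ?subr_gt0//; lra.
have q0 : p != 0 by rewrite gt_eqF//; lra.
have q1 : p - 1 != 0 by rewrite gt_eqF//; lra.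
apply: (le_trans (@conjugate_powR _ u v p (p / (p - 1)) u0 v0 _ _ _)).
- lra.
- lra.
- by field; apply/andP.
apply: lerD; rewrite ler_pdivrMr ?ler_peMr ?powR_ge0//; lra.
Qed.

(** Young's inequality is applied to [F / N] and [Y], where [N] is the norm of [F]: the first term
    then has expectation 1 and the second at most [K]. *)
Lemma Ex_mul_le_Lnorm_fin n (p s K : R) (F Y : cube n -> R) :
  1 < p -> s = p / (p - 1) ->
  Ex (fun x => `|Y x| `^ s) <= K ->
  `|Ex (fun x => F x * Y x)| <= (1 + K) * Lnorm_cube p%:E F.
Proof.
move=> p1 sE hK; rewrite /=.
set E := Ex (fun x => `|F x| `^ p).
have E0 : 0 <= E by apply: Ex_ge0 => x; exact: powR_ge0.
(* When its norm is 0, [F] cannot be normalised, but it then vanishes everywhere. *)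
have [E_eq0|En0] := eqVneq E 0.
  have F0 x : F x = 0.
    have /(_ x)/eqP := @Ex_eq0 _ _ (fun x => powR_ge0 `|F x| p) E_eq0.
    by rewrite powR_eq0 normr_eq0 => /andP[/eqP].
  rewrite (_ : (fun x => _) = fun=> 0); last first.
    by apply/funext => x; rewrite F0 mul0r.
  rewrite Ex_cst normr0 mulr_ge0 ?powR_ge0// addr_ge0//.
  by apply: le_trans hK; apply: Ex_ge0 => x; exact: powR_ge0.
set N := E `^ p^-1.
have N0 : 0 < N by rewrite powR_gt0// lt_neqAle eq_sym En0.
have NE : N `^ p = E by rewrite -powRrM mulVf ?powRr1// gt_eqF//; lra.
apply: le_trans; first exact: le_norm_Ex.
rewrite mulrC -ler_pdivrMl// -ExZ.
apply: (@le_trans _ _ (Ex (fun x => E^-1 * `|F x| `^ p + `|Y x| `^ s))).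
  apply: le_Ex => x.
  have h := @young_powR p s (N^-1 * `|F x|) `|Y x| p1 sE.
  rewrite normrM mulrA; apply: (le_trans (h _ _)) => //.
    by rewrite mulr_ge0// invr_ge0 ltW.
  rewrite powRM ?invr_ge0//; last exact: ltW.
  rewrite -[N^-1]powR_inv1; last exact: ltW.
  by rewrite powRAC NE powR_inv1.
by rewrite ExD ExZ mulVf// lerD2l.
Qed.

Lemma rfactor_gt0 (r : \bar R) : (1%:E < r)%E -> 0 < rfactor r.
Proof.
case: r => [p||]//=; rewrite lte_fin => p1.
by rewrite sqrtr_gt0 divr_gt0 ?subr_gt0// (lt_trans ltr01).
Qed.

Lemma le_Lnorm_pinfty n (F : cube n -> R) x : `|F x| <= Lnorm_cube +oo%E F.
Proof. exact: (le_bigmax _ (fun x => `|F x|)). Qed.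

(* [(rfactor r)^-1 ^+ 2] is the conjugate exponent of [r]. *)
Lemma Ex_mul_le_Lnorm n (r : \bar R) (K : R) (F Y : cube n -> R) :
  (1%:E < r)%E -> Ex (fun x => `|Y x| `^ ((rfactor r)^-1 ^+ 2)) <= K ->
  `|Ex (fun x => F x * Y x)| <= (1 + K) * Lnorm_cube r F.
Proof.
case: r => [p| |]// r1 hK.
  rewrite lte_fin in r1; apply: Ex_mul_le_Lnorm_fin hK => //=.
  rewrite exprVn sqr_sqrtr ?invf_div// divr_ge0// ?subr_ge0 ltW//.
  exact: lt_trans ltr01 r1.
(* For [r = +oo] the conjugate exponent is 1, so [K] bounds the mean of [|Y|]. *)
have M0 : 0 <= Lnorm_cube +oo%E F by exact: bigmax_ge_id.
apply: le_trans; first exact: le_norm_Ex.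
apply: (@le_trans _ _ (Lnorm_cube +oo%E F * Ex (fun x => `|Y x|))).
  rewrite -ExZ; apply: le_Ex => x.
  by rewrite normrM ler_wpM2r// le_Lnorm_pinfty.
rewrite mulrC ler_wpM2r// (le_trans _ (_ : K <= 1 + K)) ?lerDr//.
apply: le_trans hK; apply: le_Ex => x.
by rewrite /= invr1 expr1n powRr1.
Qed.

(** * Exponential moments and Khinchin's inequality *)

Lemma cosh_le_expR (t : R) : (expR t + expR (- t)) / 2 <= expR (2 * t ^+ 2).
Proof.
(* The generous factor 2 lets crude bounds suffice: for large [t], [|t| <= 2 t^2]; for small [t],
   [exp t <= 1 / (1 - t)] and its mirror image have mean [1 / (1 - t^2) <= 1 + 2 t^2]. *)
have [tbig|tsmall] := lerP 1 (2 * t ^+ 2).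
  have le_t : `|t| <= 2 * t ^+ 2.
    rewrite -[t ^+ 2]real_normK ?num_real//.
    move: tbig; rewrite -[t ^+ 2]real_normK ?num_real//.
    have := normr_ge0 t; move: (`|t|) => u; nra.
  have h1 : expR t <= expR (2 * t ^+ 2).
    by rewrite ler_expR (le_trans (ler_norm t)).
  have h2 : expR (- t) <= expR (2 * t ^+ 2).
    by rewrite ler_expR (le_trans (ler_norm (- t))) ?normrN.
  lra.
have t1 : 0 < 1 - t by nra.
have t2 : 0 < 1 + t by nra.
have h1 : expR t <= (1 - t)^-1.
  rewrite -[expR t]invrK lef_pV2 ?posrE ?invr_gt0 ?expR_gt0//.
  by rewrite -expRN; have := expR_ge1Dx (- t).
have h2 : expR (- t) <= (1 + t)^-1.
  rewrite expRN lef_pV2 ?posrE ?expR_gt0//; exact: expR_ge1Dx.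
have h3 : (1 - t)^-1 + (1 + t)^-1 = 2 * (1 - t ^+ 2)^-1.
  have h4 : 1 - t ^+ 2 = (1 - t) * (1 + t) by ring.
  rewrite h4; field; apply/andP; split; exact: lt0r_neq0.
have h5 : (1 - t ^+ 2)^-1 <= 1 + 2 * t ^+ 2.
  rewrite -[leLHS]mul1r ler_pdivrMr; nra.
have h6 := expR_ge1Dx (2 * t ^+ 2).
lra.
Qed.

Lemma Ex_expR_linear_form n (b : 'I_n -> R) :
  Ex (fun x => expR (\sum_i b i * spin x i)) <= expR (2 * \sum_i b i ^+ 2).
Proof.
pose phi (i : 'I_n) (c : bool) : R := expR (b i * (if c then -1 else 1)).
rewrite (_ : (fun x => _) = fun x : cube n => \prod_i phi i (x i)); last first.
  by apply/funext => x; rewrite expR_sum.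
rewrite Ex_prod mulr_sumr expR_sum; apply: ler_prod => i _; apply/andP; split.
  by rewrite divr_ge0 ?addr_ge0 ?expR_ge0.
by rewrite /phi mulr1 mulrN1 addrC cosh_le_expR.
Qed.

Lemma Ex_expR_abs_linear_form n (b : 'I_n -> R) :
  Ex (fun x => expR `|\sum_i b i * spin x i|) <= 2 * expR (2 * \sum_i b i ^+ 2).
Proof.
have hN := @Ex_expR_linear_form n (fun i => - b i).
have hP := @Ex_expR_linear_form n b.
have bN : \sum_i (- b i) ^+ 2 = \sum_i b i ^+ 2.
  by apply: eq_bigr => i _; rewrite sqrrN.
rewrite bN in hN.
have le_abs x : expR `|\sum_i b i * spin x i| <=
    expR (\sum_i b i * spin x i) + expR (\sum_i (- b i) * spin x i).
  under [X in _ + expR X]eq_bigr do rewrite mulNr.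
  rewrite sumrN; case: (ger0P (\sum_i b i * spin x i)) => _.
    by rewrite lerDl expR_ge0.
  by rewrite lerDr expR_ge0.
apply: le_trans; first by apply: le_Ex => x; exact: le_abs.
by rewrite ExD; lra.
Qed.

(* With [X = \sum_i b i * spin x i] and [\sum_i b i ^+ 2 = 1], this is the
   moment bound [E |X|^s <= 2 (e sqrt s)^s], obtained from
   [(t / s)^s <= exp (t - s)] at [t = sqrt s * |X|]. *)
Lemma khinchin_powR n (b : 'I_n -> R) (s : R) : 0 < s ->
  \sum_i b i ^+ 2 = 1 ->
  Ex (fun x => `|(expR 1 * Num.sqrt s)^-1 * \sum_i b i * spin x i| `^ s) <= 2.
Proof.
move=> s0 b1; have q0 : 0 < Num.sqrt s by rewrite sqrtr_gt0.
have qq : Num.sqrt s ^+ 2 = s by rewrite sqr_sqrtr// ltW.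
have bq : \sum_i (Num.sqrt s * b i) ^+ 2 = s.
  under eq_bigr do rewrite exprMn.
  by rewrite -mulr_sumr b1 mulr1 qq.
(* One factor [exp (- s)] comes from [expR 1] in the normalisation, the other from
   [(t / s)^s <= exp (t - s)]. The weights [sqrt s * b i] have square sum [s], so the exponential
   moment is at most [2 exp (2 s)], which these two factors cancel up to 2. *)
apply: (@le_trans _ _ (Ex (fun x => expR (- (2 * s)) *
    expR `|\sum_i (Num.sqrt s * b i) * spin x i|))).
  apply: le_Ex => x.
  under [X in expR `|X|]eq_bigr do rewrite -mulrA.
  rewrite -mulr_sumr; set X := \sum_i _.
  rewrite !normrM normfV normrM (gtr0_norm (expR_gt0 _)) (gtr0_norm q0).
  set t := Num.sqrt s * `|X|.
  have tX : (expR 1 * Num.sqrt s)^-1 * `|X| = expR (- 1) * (t / s).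
    rewrite expRN /t -{3}qq; field.
    by rewrite !lt0r_neq0 ?expR_gt0.
  have ts : t / s <= expR (t / s - 1).
    by have := expR_ge1Dx (t / s - 1); lra.
  have t0 : 0 <= t / s by rewrite divr_ge0 ?mulr_ge0 ?sqrtr_ge0 //; exact: ltW.
  apply: (@le_trans _ _ ((expR (- 1) * expR (t / s - 1)) `^ s)).
    rewrite tX; apply: ge0_ler_powR; first exact: ltW.
    - exact: mulr_ge0 (expR_ge0 _) t0.
    - exact: mulr_ge0 (expR_ge0 _) (expR_ge0 _).
    - by rewrite ler_wpM2l ?expR_ge0.
  rewrite -exp.expRD -expRM -exp.expRD ler_expR.
  rewrite le_eqVlt; apply/orP; left; apply/eqP; field; exact: lt0r_neq0.
rewrite ExZ.
apply: (@le_trans _ _ (expR (- (2 * s)) * (2 * expR (2 * s)))).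
  rewrite ler_wpM2l ?expR_ge0// -[in leRHS]bq; exact: Ex_expR_abs_linear_form.
by rewrite expRN mulrCA mulVf ?mulr1// lt0r_neq0 ?expR_gt0.
Qed.

(** * Lower bound *)

Lemma Qf_le_Lnorm n (r : \bar R) (F : cube n -> R) : (1%:E < r)%E ->
  Qf r F <= (4 + 3 * expR 1) * Lnorm_cube r F.
Proof.
move=> r1; set N := Lnorm_cube r F; have k0 := rfactor_gt0 _ r1.
(* Walsh functions have modulus 1, so [K = 1] works at every order. *)
have bnd S : `|fhat F S| <= 2 * N.
  apply: (@Ex_mul_le_Lnorm n r 1 F (walsh S) r1).
  under [X in Ex X]funext => x do rewrite normr_walsh powR1.
  by rewrite Ex_cst.
have h0 : `|Ex F| <= 2 * N by rewrite -fhat_set0.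
have N0 : 0 <= N by have := le_trans (normr_ge0 _) h0; lra.
have h1 : \big[Num.max/0]_(i < n) `|fhat F [set i]| <= 2 * N.
  by apply: bigmax_le => [|i _]; [rewrite mulr_ge0|exact: bnd].
suff h2 : rfactor r * Num.sqrt (\sum_(i < n) fhat F [set i] ^+ 2)
    <= 3 * expR 1 * N by rewrite QfE; lra.
set A := \sum_(i < n) _; have A0 : 0 <= A by apply: sumr_ge0 => i _; exact: sqr_ge0.
have [->|An0] := eqVneq A 0.
  by rewrite sqrtr0 mulr0 !mulr_ge0// expR_ge0.
have sA : 0 < Num.sqrt A by rewrite sqrtr_gt0 lt_neqAle eq_sym An0.
have sA2 : Num.sqrt A ^+ 2 = A by rewrite sqr_sqrtr.
pose b i := (Num.sqrt A)^-1 * fhat F [set i].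
have b1 : \sum_i b i ^+ 2 = 1.
  under eq_bigr do rewrite exprMn.
  by rewrite -mulr_sumr -/A -{2}sA2 -exprMn mulVf ?expr1n// lt0r_neq0.
have s0 : 0 < (rfactor r)^-1 ^+ 2 by rewrite exprn_gt0// invr_gt0.
(* At order [s = (rfactor r)^-2] the Khinchin constant [e sqrt s] is [e / rfactor r], which produces
   the weight [rfactor r]; the factor 3 is [1 + K] with [K = 2]. *)
have := khinchin_powR n b _ s0 b1.
rewrite sqrtr_sqr ger0_norm ?invr_ge0 ?(ltW k0)// =>
  /(Ex_mul_le_Lnorm _ _ _ F _ r1).
under [X in Ex X]funext => x do rewrite mulrCA.
rewrite ExZ fhat_linear_form.
under eq_bigr do rewrite -mulrA -expr2.
rewrite -mulr_sumr -/A -{2}sA2.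
have e0 : 0 < expR 1 :> R by exact: expR_gt0.
rewrite (_ : (expR 1 / rfactor r)^-1 * _ =
  (expR 1)^-1 * (rfactor r * Num.sqrt A)); last first.
  by field; rewrite !lt0r_neq0.
rewrite ger0_norm; last by rewrite !mulr_ge0 ?invr_ge0// ltW.
rewrite ler_pdivrMl// -/N => h; apply: (le_trans h).
by rewrite le_eqVlt; apply/orP; left; apply/eqP; ring.
Qed.

(** * Distance to [Pgt1] and upper bounds on norms *)

Lemma sub_Pgt1 n (f g : cube n -> R) : Pgt1 g ->
  Ex (fun x => f x - g x) = Ex f /\
  forall i, fhat (fun x => f x - g x) [set i] = fhat f [set i].
Proof.
move=> gP; split=> [|i]; last by rewrite fhatB gP ?cards1// subr0.
by rewrite -!fhat_set0 fhatB gP ?cards0// subr0.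
Qed.

Lemma eq_Qf n r (f g : cube n -> R) : Ex f = Ex g ->
  (forall i, fhat f [set i] = fhat g [set i]) -> Qf r f = Qf r g.
Proof.
move=> fg0 fg1; rewrite !QfE fg0; congr (_ + _ + _ * Num.sqrt _).
  by apply: eq_bigr => i _; rewrite fg1.
by apply: eq_bigr => i _; rewrite fg1.
Qed.

Lemma Lnorm_cube_ge0 n r (F : cube n -> R) : 0 <= Lnorm_cube r F.
Proof.
case: r => [p| |] //=; first exact: powR_ge0.
exact: bigmax_ge_id.
Qed.

Lemma le_distP n r (f : cube n -> R) (c : R) :
  (forall g, Pgt1 g -> c <= Lnorm_cube r (fun x => f x - g x)) ->
  c <= distP r f.
Proof.
move=> h; apply: lb_le_inf => [|_ [g gP <-]]; last exact: h.
(* The choice [g = 0] shows that the set of norms is nonempty. *)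
exists (Lnorm_cube r (fun x => f x - 0)); exists (fun=> 0) => // S _.
by rewrite /fhat ExZ mul0r.
Qed.

(** The competitor is [g = f - F], whose coefficients of levels 0 and 1 cancel. The upper bound thus
    reduces to exhibiting a suitable [F]. *)
Lemma distP_le n r (f F : cube n -> R) (B : R) : Ex F = Ex f ->
  (forall i, fhat F [set i] = fhat f [set i]) -> Lnorm_cube r F <= B ->
  distP r f <= B.
Proof.
move=> F0 F1; apply: le_trans; apply: ge_inf.
  by exists 0 => _ [g _ <-]; exact: Lnorm_cube_ge0.
exists (fun x => f x - F x) => [S|]; last first.
  by congr Lnorm_cube; apply/funext => x; ring.
rewrite leq_eqVlt ltnS leqn0 cards_eq0 fhatB => /orP[/cards1P[i ->]|/eqP->].
  by rewrite F1 subrr.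
by rewrite !fhat_set0 F0 subrr.
Qed.

(** The root only helps: [K^(1/p) <= K] because [K >= 1] and [p > 1]. *)
Lemma Lnorm_le_fin n (p B K : R) (F : cube n -> R) : 1 < p -> 0 <= B -> 1 <= K ->
  Ex (fun x => `|F x| `^ p) <= K * B `^ p -> Lnorm_cube p%:E F <= K * B.
Proof.
move=> p1 B0 K1 h; have p0 : 0 < p by exact: lt_trans ltr01 p1.
have ip0 : 0 <= p^-1 by rewrite invr_ge0 ltW.
have K0 : 0 <= K by exact: le_trans ler01 K1.
apply: (@le_trans _ _ ((K * B `^ p) `^ p^-1)).
  apply: ge0_ler_powR => //; rewrite nnegrE.
    by apply: Ex_ge0 => x; exact: powR_ge0.
  by rewrite mulr_ge0 ?powR_ge0.
rewrite powRM ?powR_ge0// -powRrM divff ?lt0r_neq0// powRr1//.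
by rewrite ler_wpM2r// ler1_powR// invf_le1// ltW.
Qed.

Lemma Lnorm_le_sup n (r : \bar R) (B : R) (F : cube n -> R) : (1%:E < r)%E ->
  (forall x, `|F x| <= B) -> Lnorm_cube r F <= B.
Proof.
move=> r1 FB; have B0 : 0 <= B by exact: le_trans (normr_ge0 _) (FB [ffun=> true]).
case: r r1 => [p||] // r1; last exact: bigmax_le.
rewrite lte_fin in r1; rewrite -[leRHS]mul1r; apply: Lnorm_le_fin => //.
rewrite mul1r -[leRHS](Ex_cst n); apply: le_Ex => x.
apply: ge0_ler_powR; rewrite ?nnegrE//.
by rewrite ltW// (lt_trans ltr01).
Qed.

(** * Real Riesz products *)

Lemma riesz_walsh n (A : comNzRingType) (c : 'I_n -> A) (S : {set 'I_n}) :
  \sum_(x : cube n) (\prod_i (1 + c i * (-1) ^+ x i)) * \prod_(i in S) (-1) ^+ x i =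
  2 ^+ n * \prod_(i in S) c i.
Proof.
(* Coordinate [i] contributes [2 * c i] if [i] is in [S], and 2 otherwise. No division occurs, so
   the identity serves real and complex coefficients alike. *)
pose phi i (b : bool) : A :=
  (1 + c i * (-1) ^+ b) * (if i \in S then (-1) ^+ b else 1).
transitivity (\sum_(x : cube n) \prod_i phi i (x i)).
  by apply: eq_bigr => x _; rewrite big_split/= -big_mkcond.
have -> : 2 ^+ n = \prod_(i < n) (2 : A) by rewrite prodr_const card_ord.
rewrite sum_cube_prod [X in _ * X]big_mkcond -big_split.
by apply: eq_bigr => i _; rewrite /phi /=; case: ifP => _; ring.
Qed.

Lemma spinE n (x : cube n) i : spin x i = (-1) ^+ x i.
Proof. by rewrite /spin; case: (x i). Qed.

Lemma walshE n (S : {set 'I_n}) (x : cube n) :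
  walsh S x = \prod_(i in S) (-1) ^+ x i.
Proof. by apply: eq_bigr => i _; rewrite spinE. Qed.

Definition riesz {n} (b : 'I_n -> R) (x : cube n) : R :=
  \prod_i (1 + b i * spin x i).

Lemma fhat_riesz n (b : 'I_n -> R) (S : {set 'I_n}) :
  fhat (riesz b) S = \prod_(i in S) b i.
Proof.
rewrite /fhat ExE -[RHS](mulKf (_ : 2 ^+ n != 0)) ?expf_neq0// -riesz_walsh.
congr (_ * _); apply: eq_bigr => x _; rewrite walshE; congr (_ * _).
by apply: eq_bigr => i _; rewrite spinE.
Qed.

Lemma Ex_riesz n (b : 'I_n -> R) : Ex (riesz b) = 1.
Proof. by rewrite -fhat_set0 fhat_riesz big_set0. Qed.

Lemma Ex_riesz_sqr n (b : 'I_n -> R) :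
  Ex (fun x => riesz b x ^+ 2) <= expR (\sum_i b i ^+ 2).
Proof.
pose phi i (c : bool) : R := (1 + b i * (-1) ^+ c) ^+ 2.
rewrite (_ : (fun x => _) = fun x : cube n => \prod_i phi i (x i)); last first.
  apply/funext => x; rewrite /riesz -prodrXl.
  by apply: eq_bigr => i _; rewrite spinE.
rewrite Ex_prod expR_sum; apply: ler_prod => i _; apply/andP; split.
  by rewrite divr_ge0 ?addr_ge0 ?sqr_ge0.
rewrite (_ : _ / 2 = 1 + b i ^+ 2) ?expR_ge1Dx// /phi expr1 expr0; by field.
Qed.

Lemma riesz_ge0 {n} (b : 'I_n -> R) x : (forall i, `|b i| <= 1) -> 0 <= riesz b x.
Proof.
move=> b1; apply: prodr_ge0 => i _; have := b1 i; rewrite ler_norml => /andP[? ?].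
by rewrite /spin; case: ifP => _; lra.
Qed.

(* Interpolation between [L_1] and [L_2], written without the Hoelder
   inequality: [w ^ p = w * w ^ (p - 1)] and [u ^ (p - 1) <= 1 + u]. *)
Lemma powR_le_interp (p w T : R) : 1 < p -> p <= 2 -> 0 <= w -> 0 < T ->
  w `^ p <= T `^ (p - 1) * (w + T^-1 * w ^+ 2).
Proof.
move=> p1 p2 w0 T0; have wT0 : 0 <= w / T by rewrite divr_ge0// ltW.
have h : (w / T) `^ (p - 1) <= 1 + w / T.
  have [wT1|wT1] := lerP 1 (w / T).
    by apply: (@le_trans _ _ (w / T)); [apply: ler1_powR; lra|lra].
  apply: (@le_trans _ _ (1 `^ (p - 1))); last by rewrite powR1; lra.
  by apply: ge0_ler_powR; rewrite ?nnegrE//; lra.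
rewrite -mulr_powRB1//; last lra.
have wE : w `^ (p - 1) = T `^ (p - 1) * (w / T) `^ (p - 1).
  rewrite -powRM//; last exact: ltW.
  by rewrite mulrC divfK// lt0r_neq0.
rewrite wE mulrCA ler_wpM2l ?powR_ge0//.
apply: (@le_trans _ _ (w * (1 + w / T))); first by rewrite ler_wpM2l.
by rewrite le_eqVlt; apply/orP; left; apply/eqP; ring.
Qed.

(** The shift by 2 is there because [|a_0 + Q (Z - 1)| <= Q (2 + Z)]. Interpolation at scale [T]
    gives [T^(p-1) (3 + (8 + T) / T)], at most [12 T^(p-1)] since [T >= 1]. *)
Lemma Ex_powR_riesz n (b : 'I_n -> R) (p : R) : 1 < p -> p <= 2 ->
  (forall i, `|b i| <= 1) -> \sum_i b i ^+ 2 <= p / (p - 1) ->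
  Ex (fun x => (2 + riesz b x) `^ p) <= 12 * expR p.
Proof.
move=> p1 p2 b1 b2; set T := expR (\sum_i b i ^+ 2).
have T0 : 0 < T by exact: expR_gt0.
have T1 : 1 <= T.
  rewrite (le_trans _ (expR_ge1Dx _))// lerDl sumr_ge0// => i _; exact: sqr_ge0.
apply: (@le_trans _ _ (Ex (fun x =>
    T `^ (p - 1) * ((2 + riesz b x) + T^-1 * (2 + riesz b x) ^+ 2)))).
  apply: le_Ex => x; apply: powR_le_interp => //.
  by rewrite addr_ge0// riesz_ge0.
rewrite ExZ ExD ExD Ex_cst Ex_riesz ExZ.
have -> : Ex (fun x => (2 + riesz b x) ^+ 2) = 8 + Ex (fun x => riesz b x ^+ 2).
  transitivity (Ex (fun x => 4 + (4 * riesz b x + riesz b x ^+ 2))).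
    by congr Ex; apply/funext => x; ring.
  rewrite ExD Ex_cst (ExD _ (fun x => 4 * riesz b x)) ExZ Ex_riesz; ring.
have hZ := @Ex_riesz_sqr n b.
have h9 : T^-1 * (8 + Ex (fun x => riesz b x ^+ 2)) <= 9.
  by rewrite ler_pdivrMl// -/T; rewrite -/T in hZ; lra.
(* The hypothesis on the square sum is tuned to [T^(p-1) = exp ((p - 1) sum_i b_i^2)]. *)
have hT : T `^ (p - 1) <= expR p.
  rewrite -expRM ler_expR; apply: (@le_trans _ _ (p / (p - 1) * (p - 1))).
    by rewrite ler_wpM2r//; lra.
  by rewrite divfK// lt0r_neq0// subr_gt0.
have := powR_ge0 T (p - 1); nra.
Qed.

(** * Imaginary parts of complex Riesz products *)

Definition imag (t : R) : complex R := Complex 0 t.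

Definition im_riesz {n} (b : 'I_n -> R) (x : cube n) : R :=
  complex.Im (\prod_i (1 + imag (b i) * (-1) ^+ x i)).

Lemma ImD (z w : complex R) :
  complex.Im (z + w) = complex.Im z + complex.Im w.
Proof. by case: z w => [? ?] [? ?]. Qed.

Lemma Im_sign (z : complex R) k :
  complex.Im (z * (-1) ^+ k) = complex.Im z * (-1) ^+ k.
Proof.
rewrite -[in LHS]signr_odd -[in RHS]signr_odd.
case: (odd k); rewrite ?expr1 ?expr0 ?mulr1// !mulrN1.
by case: z.
Qed.

(** Moves the factor [2 ^+ n] of [riesz_walsh] out of the imaginary part. *)
Lemma Im_natX (z : complex R) (m k : nat) :
  complex.Im (m%:R ^+ k * z) = m%:R ^+ k * complex.Im z.
Proof.
rewrite -!natrX !mulr_natl; elim: (expn m k) => [|l IHl]; first by rewrite !mulr0n.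
by rewrite !mulrS ImD IHl.
Qed.

Lemma fhat_im_riesz n (b : 'I_n -> R) (S : {set 'I_n}) :
  fhat (im_riesz b) S = complex.Im (\prod_(i in S) imag (b i)).
Proof.
have h := congr1 (@complex.Im R)
  (riesz_walsh _ _ (fun i => imag (b i)) S).
rewrite Im_natX (big_morph _ ImD (erefl : complex.Im (0 : complex R) = 0)) in h.
rewrite /fhat ExE -[RHS](mulKf (_ : 2 ^+ n != 0)) ?expf_neq0// -h.
congr (_ * _); apply: eq_bigr => x _.
by rewrite walshE -!expr_sum Im_sign.
Qed.

Lemma Ex_im_riesz n (b : 'I_n -> R) : Ex (im_riesz b) = 0.
Proof. by rewrite -fhat_set0 fhat_im_riesz big_set0. Qed.

(** Each factor has modulus [sqrt (1 + b_i^2) <= 1 + b_i^2 <= exp (b_i^2)], whatever the sign. *)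
Lemma norm_im_riesz n (b : 'I_n -> R) x :
  `|im_riesz b x| <= expR (\sum_i b i ^+ 2).
Proof.
have le_Im (z : complex R) : `|complex.Im z| <= Normc.normc z.
  case: z => u v /=; rewrite -sqrtr_sqr ler_wsqrtr// lerDr; exact: sqr_ge0.
apply: (le_trans (le_Im _)).
rewrite (big_morph _ (@Normc.normcM R) (@Normc.normc1 R)) expR_sum.
apply: ler_prod => i _; apply/andP; split.
  by case: (_ + _) => u v /=; exact: sqrtr_ge0.
have -> : Normc.normc (1 + imag (b i) * (-1) ^+ x i)
    = Num.sqrt (1 + b i ^+ 2).
  case: (x i); rewrite ?expr1 ?expr0 ?mulrN1 ?mulr1 /=.
    by rewrite oppr0 addr0 add0r expr1n sqrrN.
  by rewrite addr0 add0r expr1n.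
have h := expR_ge1Dx (b i ^+ 2); apply: le_trans h.
have y1 : 1 <= 1 + b i ^+ 2 by rewrite lerDl sqr_ge0.
rewrite -[leRHS]ger0_norm ?(le_trans ler01)// -sqrtr_sqr ler_wsqrtr//.
by rewrite expr2 ler_peMr// (le_trans ler01).
Qed.

Lemma Ex_affine n (c d : R) (G : cube n -> R) :
  Ex (fun x => c + d * G x) = c + d * Ex G.
Proof. by rewrite ExD Ex_cst ExZ. Qed.

Lemma fhat_affine n (c d : R) (G : cube n -> R) k :
  fhat (fun x => c + d * G x) [set k] = d * fhat G [set k].
Proof.
rewrite -[RHS]add0r -(fhat_cst n c k) /fhat -ExZ -ExD.
by congr Ex; apply/funext => x; rewrite mulrDl mulrA.
Qed.

(** * Normalising the level-1 coefficients by [Qf] *)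

Section QfBounds.
Variables (n : nat) (r : \bar R) (f : cube n -> R).
Hypothesis r1 : (1%:E < r)%E.
Let sigma := Num.sqrt (\sum_(i < n) fhat f [set i] ^+ 2).
Let Qmax_ge0 : 0 <= \big[Num.max/0]_(i < n) `|fhat f [set i]|.
Proof. exact: bigmax_ge_id. Qed.

Let Qrad_ge0 : 0 <= rfactor r * sigma.
Proof. by rewrite mulr_ge0 ?sqrtr_ge0// ltW// rfactor_gt0. Qed.

Lemma Qf_ge0 : 0 <= Qf r f.
Proof. by rewrite QfE !addr_ge0. Qed.

Lemma norm_Ex_le_Qf : `|Ex f| <= Qf r f.
Proof. by rewrite QfE; have := Qmax_ge0; have := Qrad_ge0; rewrite /sigma; lra. Qed.

Lemma norm_fhat1_le_Qf i : `|fhat f [set i]| <= Qf r f.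
Proof.
have h : `|fhat f [set i]| <= \big[Num.max/0]_(i < n) `|fhat f [set i]|.
  exact: (le_bigmax _ (fun i => `|fhat f [set i]|)).
rewrite QfE; have := Qrad_ge0; have := normr_ge0 (Ex f); rewrite /sigma; lra.
Qed.

Lemma rfactor_sqr_le_Qf :
  rfactor r ^+ 2 * (\sum_i fhat f [set i] ^+ 2) <= Qf r f ^+ 2.
Proof.
have h : rfactor r * sigma <= Qf r f.
  by rewrite QfE; have := Qmax_ge0; have := normr_ge0 (Ex f); rewrite /sigma; lra.
rewrite -[X in _ * X]sqr_sqrtr; last by apply: sumr_ge0 => i _; exact: sqr_ge0.
by rewrite -exprMn lerXn2r// nnegrE// Qf_ge0.
Qed.

(** If [d = 0], the bound by [Qf] forces the coefficient to vanish, so division by zero does no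
    harm. *)
Lemma mulr_fhat1_div (d : R) i : Qf r f <= d ->
  d * (fhat f [set i] / d) = fhat f [set i].
Proof.
move=> Qd; have [d0|d0] := eqVneq d 0; last by rewrite mulrC divfK.
have := norm_fhat1_le_Qf i; have := normr_ge0 (fhat f [set i]).
rewrite d0 mul0r => h1 h2; apply/esym/eqP; rewrite -normr_eq0 eq_le h1 andbT.
by rewrite (le_trans h2)// -d0.
Qed.

(** With [k = 1] the bound is the conjugate exponent, as wanted for [r <= 2]; with [k = 2] it is at
    most 1 when [r >= 2]. *)
Lemma sum_sqr_fhat1_div (d k : R) : 0 < k -> k * Qf r f <= d ->
  \sum_i (fhat f [set i] / d) ^+ 2 <= (k * rfactor r) ^- 2.
Proof.
move=> k0 Qd; have kQ0 : 0 <= k * Qf r f by rewrite mulr_ge0 ?Qf_ge0// ltW.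
have d0 : 0 <= d by exact: le_trans Qd.
have kr0 : 0 < (k * rfactor r) ^+ 2 by rewrite exprn_gt0// mulr_gt0// rfactor_gt0.
under eq_bigr do rewrite exprMn exprVn.
rewrite -mulr_suml; have [->|dn0] := eqVneq d 0.
  by rewrite expr0n/= invr0 mulr0 invr_ge0 ltW.
have d2 : 0 < d ^+ 2 by rewrite exprn_gt0// lt_neqAle eq_sym dn0.
rewrite ler_pdivrMr// ler_pdivlMl// exprMn -mulrA.
apply: (@le_trans _ _ ((k * Qf r f) ^+ 2)); last by rewrite lerXn2r// nnegrE.
by rewrite exprMn ler_wpM2l ?sqr_ge0// rfactor_sqr_le_Qf.
Qed.

End QfBounds.

(** * Upper bound and conclusion *)

Lemma expR1_ge1 : 1 <= expR 1 :> R.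
Proof. by have := expR_ge1Dx (1 : R); lra. Qed.

Lemma distP_le_of_le2 n (p : R) (f : cube n -> R) : 1 < p -> p <= 2 ->
  distP p%:E f <= 12 * expR 1 * Qf p%:E f.
Proof.
move=> p1 p2; have r1 : (1%:E < p%:E)%E by rewrite lte_fin.
set Q := Qf p%:E f; have Q0 : 0 <= Q by exact: Qf_ge0.
pose b i := fhat f [set i] / Q.
have b1 i : `|b i| <= 1.
  rewrite normrM normfV (ger0_norm Q0); have [->|Qn0] := eqVneq Q 0.
    by rewrite invr0 mulr0.
  rewrite ler_pdivrMr ?mul1r; first exact: norm_fhat1_le_Qf.
  by rewrite lt_neqAle eq_sym Qn0.
have b2 : \sum_i b i ^+ 2 <= p / (p - 1).
  have := @sum_sqr_fhat1_div n p%:E f r1 Q 1 ltr01.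
  rewrite !mul1r => /(_ (lexx _)) /le_trans; apply.
  rewrite /= sqr_sqrtr ?invf_div//; apply: divr_ge0; lra.
apply: (@distP_le n p%:E f (fun x => (Ex f - Q) + Q * riesz b x)).
- by rewrite Ex_affine Ex_riesz; ring.
- move=> i; rewrite fhat_affine fhat_riesz big_set1.
  exact: (@mulr_fhat1_div n p%:E f r1 Q i (lexx _)).
have e1 := expR1_ge1.
(* Here [K = 12] and [B = e Q]: the factor [e^p] of the moment is absorbed into [B^p]. *)
rewrite -mulrA; apply: Lnorm_le_fin => //; [by rewrite mulr_ge0 ?expR_ge0|lra|].
apply: (@le_trans _ _ (Ex (fun x => Q `^ p * (2 + riesz b x) `^ p))).
  apply: le_Ex => x; have Z0 : 0 <= riesz b x by exact: riesz_ge0.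
  rewrite -powRM//; last by rewrite addr_ge0.
  apply: ge0_ler_powR; rewrite ?nnegrE//; first lra.
    by rewrite mulr_ge0// addr_ge0.
  have h0 : `|Ex f| <= Q by exact: norm_Ex_le_Qf.
  rewrite -[Ex f - Q + _]addrA (le_trans (ler_normD _ _))//.
  apply: (@le_trans _ _ (Q + (Q + Q * riesz b x))); last lra.
  rewrite lerD// (le_trans (ler_normD _ _))// normrN (ger0_norm Q0).
  by rewrite ger0_norm// mulr_ge0.
rewrite ExZ powRM ?expR_ge0// -expRM mul1r.
have := Ex_powR_riesz n b p p1 p2 b1 b2; have := powR_ge0 Q p.
move: (Ex _) (Q `^ p) => u v; nra.
Qed.

Lemma distP_le_of_ge2 n (r : \bar R) (f : cube n -> R) : (2%:E <= r)%E ->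
  distP r f <= 12 * expR 1 * Qf r f.
Proof.
move=> r2; have r1 : (1%:E < r)%E by apply: lt_le_trans r2; rewrite lte_fin; lra.
(* For [r >= 2], [(rfactor r)^2 = 1 - 1/r >= 1/2]. *)
have k2 : 1 <= (2 * rfactor r) ^+ 2.
  case: r r1 r2 => [p||]//=; last by rewrite mulr1; lra.
  rewrite lte_fin lee_fin => p1 p2; rewrite exprMn sqr_sqrtr; last first.
    by apply: divr_ge0; lra.
  rewrite mulrA ler_pdivlMr; lra.
set Q := Qf r f; have Q0 : 0 <= Q by exact: Qf_ge0.
have e1 := expR1_ge1.
pose b i := fhat f [set i] / (2 * Q).
have b2 : \sum_i b i ^+ 2 <= 1.
  apply: le_trans; first exact: (@sum_sqr_fhat1_div n r f r1 (2 * Q) 2).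
  by rewrite invf_le1// (lt_le_trans ltr01).
apply: (@distP_le n r f (fun x => Ex f + (2 * Q) * im_riesz b x)).
- by rewrite Ex_affine Ex_im_riesz mulr0 addr0.
- move=> i; rewrite fhat_affine fhat_im_riesz big_set1.
  by apply: (@mulr_fhat1_div n r f r1); rewrite -/Q; lra.
apply: Lnorm_le_sup => // x.
have hG : `|im_riesz b x| <= expR 1.
  by rewrite (le_trans (norm_im_riesz _ _ _))// ler_expR.
have h0 : `|Ex f| <= Q by exact: norm_Ex_le_Qf.
apply: le_trans; first exact: ler_normD.
rewrite (normrM (2 * Q)) (@ger0_norm _ (2 * Q)) ?mulr_ge0//.
(* [Q + 2 Q e <= 12 e Q], as [e >= 1]. *)
nra.
Qed.

Theorem theorem1p2 :
  exists c C : R, 0 < c /\ c <= C /\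
    forall (r : \bar R) (n : nat) (f : cube n -> R),
      (1%:E < r)%E ->
      c * Qf r f <= distP r f /\ distP r f <= C * Qf r f.
Proof.
have e1 := expR1_ge1.
have c0 : 0 < 4 + 3 * expR 1 :> R by lra.
exists (4 + 3 * expR 1)^-1, (12 * expR 1); split; first by rewrite invr_gt0.
split.
  apply: (@le_trans _ _ 1); last lra.
  by rewrite invf_le1//; lra.
move=> r n f r1; split.
  apply: le_distP => g gP; rewrite ler_pdivrMl//.
  (* [Qf] sees only levels 0 and 1, which [f] and [f - g] share. *)
  have [g0 g1] := sub_Pgt1 n f g gP.
  by rewrite -(eq_Qf _ _ _ _ g0 g1); exact: Qf_le_Lnorm.
have [r2|r2] := leP 2%:E r; first exact: distP_le_of_ge2.
case: r r1 r2 => [p||]//; rewrite !lte_fin => p1 p2.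
by apply: distP_le_of_le2 => //; exact: ltW.
Qed.
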